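(* Let $m\ge 2$ and $n\ge 1$ be integers, let $B_m^n=\{z\in\mathbb{C}^n : z_i^m=1 \text{ for } i=1,\dots,n\}$, let $Q$ be an $n\times n$ Hermitian matrix and consider the function $f:B_m^n\to\mathbb{R}$ defined by $$f(z)=z^*Qz=\sum_{1\le i,j\le n}Q_{ij}\,z_i^{-1}z_j .$$ Assume that $f(z)\ge 0$ for all $z\in B_m^n$. Then $f$ admits a sum-of-squares certificate of the form $f(z)=\sum_{j=1}^r|g_j(z)|^2$ for all $z\in B_m^n$, where each $g_j:B_m^n\to\mathbb{R}$ is supported on $$\mathcal{M}(\lfloor n/2\rfloor+1)=\{z^\alpha : \alpha\in\{0,\dots,m-1\}^n,\ n_j(\alpha)\le\lfloor n/2\rfloor+1\ \text{ for all } 1\le j\le m-1\}.$$ In short, the level-$k$ sum-of-squares hierarchy for the problem $\max\{z^*Qz : z\in B_m^n\}$ (with $Q$ any $n\times n$ Hermitian matrix) is exact for $k=\lfloor n/2\rfloor+1$.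
   Context: For $z\in\mathbb{C}^n$, $z^*$ is the conjugate transpose. For $\alpha\in\{0,\dots,m-1\}^n$, $z^\alpha=\prod_{i=1}^n z_i^{\alpha_i}$, regarded as a function on $B_m^n$, and for $1\le i\le m-1$, $n_i(\alpha)=|\{l\in\{1,\dots,n\}:\alpha_l=i\}|$ is the number of variables with exponent $i$. The monomials $z^\alpha$, $\alpha\in\{0,\dots,m-1\}^n$, form a basis (the Fourier basis) of the complex vector space of functions $B_m^n\to\mathbb{C}$. A function is supported on a set of monomials if it is a complex linear combination of monomials in that set. For an integer $k$, the level-$k$ monomials are $\mathcal{M}(k)=\{z^\alpha:\alpha\in\{0,\dots,m-1\}^n,\ n_i(\alpha)\le k\text{ for all }1\le i\le m-1\}$. A function $h$ on $B_m^n$ is a $k$-sum-of-squares if $h(z)=\sum_j|g_j(z)|^2$ on $B_m^n$ for finitely many functions $g_j:B_m^n\to\mathbb{C}$ that are linear combinations of monomials from $\mathcal{M}(k)$. The level-$k$ sum-of-squares hierarchy for $\max\{z^*Qz:z\in B_m^n\}$ is the problem of minimizing $t\in\mathbb{R}$ subject to $z\mapsto t-z^*Qz$ being a $k$-sum-of-squares; it is exact if its optimal value equals $\max\{z^*Qz:z\in B_m^n\}$. *)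

(* Defs.v *)
From mathcomp Require Import all_boot all_order all_algebra.
From mathcomp Require Import complex.
From mathcomp Require Import classical_sets reals constructive_ereal ereal.

Set Implicit Arguments.
Unset Strict Implicit.
Unset Printing Implicit Defensive.

Import Order.TTheory GRing.Theory Num.Theory.

Local Open Scope ring_scope.
Local Open Scope complex_scope.
Local Open Scope sesquilinear_scope.

(* B_m^n as a subtype of the column vectors, so that "function on B_m^n" is
   literally a function out of this type. *)
Definition rootbox (R : realType) (m n : nat) : Type :=
  {z : 'cV[R[i]]_n | [forall i, z i ord0 ^+ m == 1]}.

Definition quad_form (R : realType) (m n : nat) (Q : 'M[R[i]]_n)
    (z : rootbox R m n) : R[i] :=
  ((val z)^t (@Num.conj R[i]) *m Q *m val z) ord0 ord0.

Notation exponent m n := {ffun 'I_n -> 'I_m}.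

Definition monomial (R : realType) (m n : nat) (a : exponent m n)
    (z : rootbox R m n) : R[i] :=
  \prod_(l < n) (val z l ord0) ^+ a l.

Definition nvars (m n : nat) (a : exponent m n) (i : 'I_m) : nat :=
  #|[set l : 'I_n | a l == i]|.

(* The monomials are distinct for distinct exponents, hence a set of monomials
   is encoded by its set of exponents. *)
Definition level (m n k : nat) : {set exponent m n} :=
  [set a : exponent m n |
    [forall i : 'I_m, (0 < i)%N ==> (nvars a i <= k)%N]].

Definition supported_on (R : realType) (m n : nat)
    (S : {set exponent m n}) (g : rootbox R m n -> R[i]) : Prop :=
  exists c : exponent m n -> R[i],
    forall z, g z = \sum_(a in S) c a * monomial a z.

Definition is_sos (R : realType) (m n k : nat)
    (h : rootbox R m n -> R[i]) : Prop :=
  exists (r : nat) (g : 'I_r -> rootbox R m n -> R[i]),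
    (forall j, supported_on (level m n k) (g j)) /\
    (forall z, h z = \sum_(j < r) `|g j z| ^+ 2).

Definition sos_feasible (R : realType) (m n k : nat) (Q : 'M[R[i]]_n) : set R :=
  [set t : R | is_sos k (fun z : rootbox R m n => t%:C - quad_form Q z)]%classic.

(* The infimum is taken in the extended reals: the value is +oo when no t is
   feasible. *)
Definition sos_value (R : realType) (m n k : nat) (Q : 'M[R[i]]_n) : \bar R :=
  ereal_inf [set t%:E | t in sos_feasible m k Q]%classic.

(* [u <= v] in R[i] means that v - u is a nonnegative real, so the second
   clause also asserts that the quadratic form is real-valued. *)
Definition is_quad_max (R : realType) (m n : nat) (Q : 'M[R[i]]_n)
    (v : R) : Prop :=
  (exists z : rootbox R m n, quad_form Q z = v%:C) /\
  (forall z : rootbox R m n, quad_form Q z <= v%:C).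

Definition sos_exact (R : realType) (m n k : nat) (Q : 'M[R[i]]_n) : Prop :=
  exists v : R, is_quad_max m Q v /\ sos_value m k Q = v%:E.

Lemma quad_formE (R : realType) (m n : nat) (hm : (0 < m)%N)
    (Q : 'M[R[i]]_n) (z : rootbox R m n) :
  quad_form Q z =
  \sum_(i < n) \sum_(j < n) Q i j * (val z i ord0)^-1 * val z j ord0.
Proof.
rewrite /quad_form mxE exchange_big /=; apply: eq_bigr => j _.
rewrite mxE big_distrl /=; apply: eq_bigr => i _.
rewrite !mxE; congr (_ * _); rewrite mulrC; congr (_ * _).
have /forallP/(_ i)/eqP zi := valP z.
have n1 : `|val z i ord0| = 1.
  by apply/eqP; rewrite -(pexpr_eq1 hm) // -normrX zi normr1.
by rewrite invC_norm n1 expr1n invr1 mul1r.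
Qed.

(* Main.v *)
Require Import Defs.
From mathcomp Require Import all_boot all_order all_algebra.
From mathcomp Require Import complex.
From mathcomp Require Import reals.
From mathcomp Require Import constructive_ereal ereal.
From mathcomp Require Import cyclic separable zify ring.

Set Implicit Arguments.
Unset Strict Implicit.
Unset Printing Implicit Defensive.

Import Order.TTheory GRing.Theory Num.Theory.
Local Open Scope ring_scope.

(** Write [f = \sum_g fhat(g) z^g], the exponents [g] being elements of the
group [G = (Z/m)^n].  For a quadratic form, [fhat] lives on the differences
[e_j - e_i] of unit exponents.  The kernel [fhat (a - b)] on [G * G] is
diagonalized by the points of the box, with eigenvalues proportional to the
values of [f], so [f >= 0] makes it a Gram kernel; and evaluating it on
monomials recovers [f], because each [g] is a difference [a - b] in [#|G|]
ways.  Any way of writing the kernel as a sum of rank-one terms [u u^*]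
therefore writes [f] as a sum of squares [|\sum_a u a z^a|^2], and what is
needed is a decomposition whose vectors [u] have small supports.

The kernel is sparse: it vanishes at [(a, b)] unless [a] and [b] differ by some
[e_j - e_i].  Gram-Schmidt orthogonalization performed in a perfect elimination
order of a chordal graph containing this pattern gives vectors [u] supported on
cliques of that graph ([chordal_gram], [chordal_sos]).

The chordal graph is star shaped.  Let [k = n./2 + 1].  A residue [c] is
dominant in the exponent [a] if more than [k] coordinates of [a] equal [c];
since [2 k > n], at most one residue is dominant, and moving two coordinates
cannot replace a dominant residue by another one ([compatible_edit]).  Joining
all pairs of exponents that do not have distinct dominant residues gives one
central clique, of the exponents without dominant residue, to which the
exponents dominated by [c] are attached, for each [c].  Eliminating the
exponents with a dominant residue before the others creates no new edge
([compatible_elim_order]).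

On a clique, at most one residue [c] is dominant.  Dividing a function supported
on this clique by the monomial [\prod_l z_l ^ c], which has modulus 1, turns the
residue [c] into [0], whose multiplicity is not restricted: the quotient has
level [k] ([clique_center]).  Finally the level is stable under
[a |-> - a], that is under complex conjugation, so that the real and imaginary
parts of these functions also have level [k], which gives real squares.

Exactness follows: if [v] is the maximum of the form of [Q], then [v - z^* Q z]
is the form of the matrix [v / n - Q], because [z^* z = n] on the box, so [v] is
feasible by the first part; and a feasible [t] is at least [v], as seen at a
maximizer. *)

(** * Positive semidefinite kernels with a chordal sparsity pattern *)

(** Projecting all vectors [M a] onto the orthogonal complement of [M v] subtracts
from the Gram kernel the rank-one term [u u^*], where [u] is the normalized
column [v] of the kernel.  When [M v = 0], the convention [0^-1 = 0] makes
[u = 0] and leaves everything unchanged. *)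
Lemma gram_schmidt_step (C : numClosedFieldType) (T K : finType)
    (M : T -> K -> C) (v : T) :
  exists (u : T -> C) (M' : T -> K -> C),
    [/\ forall a, \sum_k M a k * (M v k)^* = 0 -> u a = 0 /\ M' a =1 M a,
        forall k, M' v k = 0
      & forall a b, \sum_k M a k * (M b k)^* =
          u a * (u b)^* + \sum_k M' a k * (M' b k)^*].
Proof.
pose A a b := \sum_k M a k * (M b k)^*.
have Aconj a b : (A a b)^* = A b a.
  rewrite rmorph_sum; apply: eq_bigr => k _.
  by rewrite rmorphM /= conjCK mulrC.
have Avv_ge0 : 0 <= A v v.
  by apply: sumr_ge0 => k _; rewrite -normCK exprn_ge0.
have Avv_conj : (A v v)^* = A v v by rewrite Aconj.
exists (fun a => A a v / sqrtC (A v v)).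
exists (fun a k => M a k - A a v / A v v * M v k); split.
- move=> a; rewrite -/(A a v) => ->; rewrite !mul0r; split => // k.
  by rewrite mul0r subr0.
- move=> k; have [Avv0 | Avv0] := eqVneq (A v v) 0.
    suff -> : M v k = 0 by rewrite mulr0 subr0.
    apply/eqP; rewrite -normr_eq0 -sqrf_eq0 normCK; apply/eqP.
    by apply: (psumr_eq0P _ Avv0) => // l _; rewrite -normCK exprn_ge0.
  by rewrite divff // mul1r subrr.
move=> a b; rewrite -/(A a b).
have -> : \sum_k (M a k - A a v / A v v * M v k) * (M b k - A b v / A v v * M v k)^* =
  A a b - A a v / A v v * A v b - (A b v / A v v)^* * (A a v)
   + A a v / A v v * (A b v / A v v)^* * A v v.
  rewrite /A !mulr_sumr -!sumrB -big_split /=; apply: eq_bigr => k _.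
  rewrite !rmorphB !rmorphM /= -/(A a v) -/(A v v) -/(A b v).
  by ring.
rewrite !rmorphM !fmorphV /= Aconj Avv_conj (geC0_conj (x := sqrtC _)) ?sqrtC_ge0 //.
rewrite mulrACA -invfM -expr2 sqrtCK.
have [-> | Avv0] := eqVneq (A v v) 0; first by rewrite invr0 !(mulr0, mul0r); ring.
by field.
Qed.

(** The decomposition theorem for positive semidefinite matrices with a chordal
pattern.  Eliminating first the vertices of least [rank], the vector [u] produced
by [gram_schmidt_step] is supported on [v] and its remaining neighbours; the
hypothesis on [rank] makes them a clique, so that the remaining kernel is still
supported on [e].  Vertices of equal rank may be eliminated in any order. *)
Lemma chordal_gram (C : numClosedFieldType) (T K : finType) (e : rel T)
    (rank : T -> nat)
    (elim_order : forall v a b : T, (rank v <= rank a)%N -> (rank v <= rank b)%N ->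
       e a v -> e b v -> e a b)
    (M : T -> K -> C)
    (M_sparse : forall a b, \sum_k M a k * (M b k)^* != 0 -> e a b) :
  exists us : seq {ffun T -> C},
    (forall u, u \in us -> forall a b, u a != 0 -> u b != 0 -> e a b) /\
    (forall a b, \sum_k M a k * (M b k)^* = \sum_(u <- us) u a * (u b)^*).
Proof.
(* Generalize to vectors that vanish outside a set [S] of vertices that are not
yet eliminated, and induct on the size of [S]. *)
have: forall a, a \notin [set: T] -> M a =1 fun=> 0 by move=> a; rewrite inE.
have [r] := ubnP #|[set: T]|.
elim: r [set: T] M M_sparse => // r IH S M M_sparse ltSr M_out.
have [S0 | [v0 v0S]] := set_0Vmem S.
  exists [::]; split => // a b; rewrite big_nil big1 // => k _.
  by rewrite M_out ?mul0r // S0 inE.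
case: (arg_minnP rank v0S) => v /= vS v_min.
have [u [M' [u_orth M'v MM']]] := gram_schmidt_step M v.
have u_supp a : u a != 0 -> e a v /\ (rank v <= rank a)%N.
  move=> ua; have Aav : \sum_k M a k * (M v k)^* != 0.
    by apply: contra_neq ua => /u_orth[].
  split; first exact: M_sparse.
  apply: v_min; apply: contraR Aav => /M_out Ma0.
  by apply/eqP; rewrite big1 // => k _; rewrite Ma0 mul0r.
have u_clique a b : u a != 0 -> u b != 0 -> e a b.
  by move=> /u_supp[eav va] /u_supp[ebv vb]; apply: elim_order va vb eav ebv.
have [||a|us [us_clique M'us]] := IH (S :\ v) M'.
- move=> a b M'ab; have [ua0 | ua] := eqVneq (u a) 0; last first.
    have [ub0 | ub] := eqVneq (u b) 0; last exact: u_clique.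
    by apply: M_sparse; rewrite MM' ub0 conjC0 mulr0 add0r.
  by apply: M_sparse; rewrite MM' ua0 mul0r add0r.
- by move: ltSr; rewrite (cardsD1 v) (vS : v \in S).
- rewrite !inE negb_and negbK => /orP[/eqP-> k|/M_out Ma0 k]; first exact: M'v.
  have /u_orth[_ ->] : \sum_k M a k * (M v k)^* = 0; last exact: Ma0.
  by rewrite big1 // => l _; rewrite Ma0 mul0r.
exists ([ffun a => u a] :: us); split=> [w | a b].
  by rewrite inE => /predU1P[-> a b|/us_clique //]; rewrite !ffunE; apply: u_clique.
by rewrite big_cons !ffunE MM' M'us.
Qed.

(** * Characters of (Z/m)^n *)

(** The monomial of exponent [a] at a point [z] which need not be in the box.  For
[z] in the box, it is a character in [a] of the group of exponents modulo [m].
Moduli at least 2 are written [m.+2] because ['I_m.+2] is canonically the ring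
of integers modulo [m.+2]. *)
Definition char (C : numClosedFieldType) (m n : nat) (z : 'I_n -> C)
    (a : exponent m n) : C := \prod_(l < n) z l ^+ a l.

Lemma unity_conj (C : numClosedFieldType) (m : nat) (x : C) :
  (0 < m)%N -> x ^+ m = 1 -> x * x^* = 1.
Proof.
move=> m0 xm; rewrite -normCK; suff -> : `|x| = 1 by rewrite expr1n.
by apply/eqP; rewrite -(pexpr_eq1 m0) // -normrX xm normr1.
Qed.

Lemma expr_ordD (C : numClosedFieldType) (m : nat) (x : C) (i j : 'I_m.+2) :
  x ^+ m.+2 = 1 -> x ^+ (i + j)%R = x ^+ i * x ^+ j.
Proof. by move=> xm; rewrite -exprD -[RHS](expr_mod _ xm). Qed.

Section Characters.
Context (C : numClosedFieldType) (m n : nat).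
Local Notation G := (exponent m.+2 n).
Implicit Types (z : 'I_n -> C) (a b : G).

Lemma charD z a b : (forall l, z l ^+ m.+2 = 1) ->
  char z (a + b) = char z a * char z b.
Proof.
by move=> hz; rewrite -big_split; apply: eq_bigr => l _; rewrite ffunE expr_ordD.
Qed.

Lemma char0 z : char z (0 : G) = 1.
Proof. by rewrite /char big1 // => l _; rewrite ffunE expr0. Qed.

Lemma char_conj z a : (forall l, z l ^+ m.+2 = 1) -> char z a * (char z a)^* = 1.
Proof.
move=> hz; rewrite rmorph_prod -big_split big1 //= => l _.
by rewrite (@unity_conj _ m.+2) // exprAC hz expr1n.
Qed.

Lemma charN z a : (forall l, z l ^+ m.+2 = 1) -> char z (- a) = (char z a)^*.
Proof.
move=> hz; rewrite -[LHS]mulr1 -(char_conj a hz) mulrA -charD // addNr char0.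
by rewrite mul1r.
Qed.

Lemma charB z a b : (forall l, z l ^+ m.+2 = 1) ->
  char z (a - b) = char z a * (char z b)^*.
Proof. by move=> hz; rewrite charD // charN. Qed.

Lemma geometric_unity (x : C) : x ^+ m.+2 = 1 ->
  \sum_(k < m.+2) x ^+ k = (m.+2 * (x == 1))%:R.
Proof.
move=> xm; have [-> | x1] := eqVneq.
  by under eq_bigr do rewrite expr1n; rewrite sumr_const card_ord muln1.
have {}x1 : x - 1 != 0 by rewrite subr_eq0.
apply: (mulfI x1).
by rewrite -subrX1 xm subrr muln0 mulr0.
Qed.

Lemma char_sum z : (forall l, z l ^+ m.+2 = 1) ->
  \sum_(a : G) char z a = (m.+2 ^ n * [forall l, z l == 1])%:R.
Proof.
move=> hz; rewrite -(bigA_distr_bigA (fun l (k : 'I_m.+2) => z l ^+ k)) /=.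
under eq_bigr => l _ do rewrite geometric_unity //.
have [/forallP z1 | /forallPn[l zl]] := boolP [forall l, z l == 1].
  under eq_bigr => l _ do rewrite z1 muln1.
  by rewrite prodr_const card_ord muln1 natrX.
by rewrite (bigD1 l) //= (negPf zl) !muln0 mul0r.
Qed.

End Characters.

Lemma prim_root_exists (C : numClosedFieldType) (m : nat) :
  (0 < m)%N -> exists zeta : C, m.-primitive_root zeta.
Proof.
move=> m0; pose p : {poly C} := 'X^m - 1.
have [r Dp] := closed_field_poly_normal p.
move: Dp; rewrite (monicP _) ?monicXnsubC // scale1r => Dp.
have rn1 : all m.-unity_root r by apply/allP => z; rewrite -root_prod_XsubC -Dp.
have sz_r : (m < (size r).+1)%N by rewrite -(size_prod_XsubC r id) -Dp size_XnsubC.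
have [|z] := hasP (has_prim_root m0 rn1 _ sz_r); last by exists z.
by rewrite -separable_prod_XsubC -Dp cyclotomic.separable_Xn_sub_1 // pnatr_eq0 -lt0n.
Qed.

(** * Sparse sums of squares on the group of roots of unity *)

Section Sparse.
Context (C : numClosedFieldType) (m n : nat).
Local Notation G := (exponent m.+2 n).
Implicit Types (z : 'I_n -> C) (a b d g : G).

(** The points of the box are themselves indexed by exponents; this makes the
pairing of points and exponents symmetric ([char_root_pointC]), and both families
of orthogonality relations the same. *)
Definition root_point (zeta : C) d : 'I_n -> C := fun l => zeta ^+ d l.

Context (zeta : C) (zeta_prim : m.+2.-primitive_root zeta).

Lemma root_pointX d l : root_point zeta d l ^+ m.+2 = 1.
Proof. by rewrite /root_point exprAC (prim_expr_order zeta_prim) expr1n. Qed.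

Lemma char_root_pointC a d : char (root_point zeta d) a = char (root_point zeta a) d.
Proof. by apply: eq_bigr => l _; rewrite /root_point exprAC. Qed.

Lemma sum_char_root_point a :
  \sum_d char (root_point zeta d) a = (m.+2 ^ n * (a == 0))%:R.
Proof.
under eq_bigr => d _ do rewrite char_root_pointC.
rewrite char_sum; last exact: root_pointX.
congr (_ * nat_of_bool _)%:R; apply/forallP/eqP => [a1 | -> l].
  apply/ffunP => l; apply/val_inj; rewrite ffunE /=.
  move: (a1 l); rewrite /root_point -(expr0 zeta) (eq_prim_root_expr zeta_prim).
  by rewrite mod0n modn_small // => /eqP.
by rewrite /root_point ffunE.
Qed.

(** A nonnegative function whose Fourier support fits a chordal graph [e] is a sum
of squares supported on cliques of [e]: the kernel [phat (a - b)] is, up to a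
factor, the Gram kernel of the functions [sqrt p * conj (z^a)], to which
[chordal_gram] applies. *)
Lemma chordal_sos (e : rel G) (rank : G -> nat) (phat : G -> C)
    (elim_order : forall v a b, (rank v <= rank a)%N -> (rank v <= rank b)%N ->
       e a v -> e b v -> e a b)
    (phat_sparse : forall a b, phat (a - b) != 0 -> e a b)
    (p_ge0 : forall z, (forall l, z l ^+ m.+2 = 1) ->
       0 <= \sum_g phat g * char z g) :
  exists us : seq {ffun G -> C},
    (forall u, u \in us -> forall a b, u a != 0 -> u b != 0 -> e a b) /\
    (forall z, (forall l, z l ^+ m.+2 = 1) ->
       \sum_g phat g * char z g =
       \sum_(u <- us) `|\sum_a u a * char z a| ^+ 2).
Proof.
pose N : C := (m.+2 ^ n)%:R.
have N0 : N != 0 by rewrite pnatr_eq0 expn_eq0.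
pose p d := \sum_g phat g * char (root_point zeta d) g.
have p0 d : 0 <= p d by apply: p_ge0; apply: root_pointX.
pose M a d := sqrtC (p d) * (char (root_point zeta d) a)^* / N.
have gram a b : \sum_d M a d * (M b d)^* = phat (a - b) / N.
  have MM d : M a d * (M b d)^* =
      \sum_g phat g / N ^+ 2 * char (root_point zeta d) (g - (a - b)).
    rewrite /M !rmorphM fmorphV /= conjCK rmorph_nat.
    rewrite (geC0_conj (x := sqrtC _)) ?sqrtC_ge0 // -/N.
    have -> : forall s x y : C, s * x / N * (s * y / N) = s ^+ 2 * (x * y / N ^+ 2).
      by move=> s x y; field.
    rewrite sqrtCK /p mulr_suml; apply: eq_bigr => g _.
    rewrite !charB; try exact: root_pointX.
    by rewrite rmorphM /= conjCK; ring.
  under eq_bigr => d _ do rewrite MM.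
  rewrite exchange_big /= (bigD1 (a - b)) //= [X in _ + X]big1 ?addr0 => [|g ne_g].
    rewrite -mulr_sumr sum_char_root_point subrr eqxx muln1 -/N; by field.
  by rewrite -mulr_sumr sum_char_root_point subr_eq0 (negPf ne_g) muln0 mulr0.
have [|us [us_clique us_gram]] := @chordal_gram C G G e rank elim_order M.
  move=> a b; rewrite gram mulf_eq0 invr_eq0 (negPf N0) orbF; exact: phat_sparse.
exists us; split => // z hz.
(* Each [g] is [a - b] for exactly [N] pairs [(a, b)]. *)
transitivity (\sum_(a : G) \sum_(b : G) phat (a - b) / N * char z (a - b)).
  rewrite exchange_big /=.
  have shift b : \sum_(a : G) phat (a - b) / N * char z (a - b) =
      (\sum_g phat g * char z g) / N.
    rewrite (reindex (fun g => g + b)) /=; last first.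
      by exists (fun a => a - b) => a _; rewrite ?addrK ?subrK.
    rewrite mulr_suml; apply: eq_bigr => g _; rewrite addrK; by ring.
  under [RHS]eq_bigr => b _ do rewrite shift.
  rewrite sumr_const card_ffun !card_ord -mulr_natr -/N; by field.
transitivity (\sum_(a : G) \sum_(b : G) \sum_(u <- us)
    (u a * char z a) * (u b * char z b)^*).
  apply: eq_bigr => a _; apply: eq_bigr => b _; rewrite -gram us_gram mulr_suml.
  by apply: eq_bigr => u _; rewrite charB // rmorphM /=; ring.
under eq_bigr => a _ do rewrite exchange_big /=.
rewrite exchange_big /=; apply: eq_bigr => u _.
rewrite normCK rmorph_sum mulr_suml; apply: eq_bigr => a _.
by rewrite mulr_sumr.
Qed.

End Sparse.

(** * The star-shaped chordal graph on exponents *)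

Section Graph.
Context (m n : nat).
Local Notation G := (exponent m.+2 n).
Implicit Types (a b v : G) (c d : 'I_m.+2).

Lemma nvars_disjoint a c d : c != d -> (nvars a c + nvars a d <= n)%N.
Proof.
move=> ne_cd; rewrite /nvars -cardsUI -[X in (_ <= X)%N]card_ord.
rewrite [X in (_ + X)%N](_ : _ = 0%N) ?addn0 ?max_card //.
apply: eq_card0 => l; rewrite !inE; apply/negbTE; apply: contra ne_cd.
by case/andP => /eqP <- /eqP <-.
Qed.

Lemma nvars_edit a b i j c : (forall l, l != i -> l != j -> a l = b l) ->
  (nvars a c <= nvars b c + 2)%N.
Proof.
move=> ab.
have sub : [set l | a l == c] \subset [set l | b l == c] :|: [set i; j].
  apply/subsetP => l; rewrite !inE.
  have [_|li] := eqVneq l i; first by rewrite /= orbT.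
  have [_|lj] := eqVneq l j; first by rewrite /= orbT.
  by rewrite ab // => ->.
apply: leq_trans (subset_leq_card sub) (leq_trans (leq_card_setU _ _) _).
by rewrite leq_add2l cards2; case: (i != j).
Qed.

Definition shift_exponent c : G := [ffun=> c].

Lemma nvarsB a c d : nvars (a - shift_exponent c) d = nvars a (d + c).
Proof.
by rewrite /nvars; congr #|pred_of_set _|; apply/setP => l; rewrite !inE !ffunE subr_eq.
Qed.

Lemma nvarsN a d : nvars (- a) d = nvars a (- d).
Proof.
by rewrite /nvars; congr #|pred_of_set _|; apply/setP => l; rewrite !inE !ffunE eqr_oppLR.
Qed.

(** The star-shaped graph.  Quantifying over the pairs of residues avoids choosing a
dominant residue, which need not exist and is unique only for [k] large. *)
Definition compatible (k : nat) : rel G := fun a b =>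
  [forall c, forall d, (k < nvars a c)%N && (k < nvars b d)%N ==> (c == d)].

Lemma compatibleP k a b : reflect
  (forall c d, (k < nvars a c)%N -> (k < nvars b d)%N -> c = d) (compatible k a b).
Proof.
apply: (iffP forallP) => [ab c d ac bd | ab c].
  by apply/eqP; have /forallP/(_ d)/implyP := ab c; apply; apply/andP.
by apply/forallP => d; apply/implyP => /andP[ac bd]; apply/eqP; apply: ab.
Qed.

(** The exponents of the central clique, without dominant residue. *)
Definition light (k : nat) a : bool := [forall c, (nvars a c <= k)%N].

(** The rank is [0] for exponents with a dominant residue and [1] for the others.
All neighbours of an exponent with dominant residue [x] have no dominant residue
other than [x]; and the last exponents to be eliminated form the central
clique. *)
Lemma compatible_elim_order k v a b :
  (light k v <= light k a)%N -> (light k v <= light k b)%N ->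
  compatible k a v -> compatible k b v -> compatible k a b.
Proof.
have [/forallP vL | /forallPn[x vx]] := boolP (light k v).
  rewrite lt0b => /forallP aL _ _ _; apply/compatibleP => c d.
  by rewrite ltnNge aL.
move=> _ _ /compatibleP av /compatibleP bv; apply/compatibleP => c d ac bd.
by rewrite -ltnNge in vx; rewrite (av _ _ ac vx) (bv _ _ bd vx).
Qed.

(** If [c] is dominant in [a] and [d <> c] in [b], then [b] has more than [k]
coordinates equal to [d] and at least [k - 1] equal to [c], hence at least
[2 k > n] coordinates. *)
Lemma compatible_edit k a b i j : (n < k.*2)%N ->
  (forall l, l != i -> l != j -> a l = b l) -> compatible k a b.
Proof.
move=> ltnk ab; apply/compatibleP => c d ac bd; apply/eqP; apply: contraTT ltnk => ne_cd.
have := nvars_edit c ab; have := nvars_disjoint b ne_cd; lia.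
Qed.

(** The residue [c] is the one that is dominant somewhere in the clique, if any.
The shift moves it to [0], the exponent of a variable that does not occur in the
monomial, and which the level does not restrict. *)
Lemma clique_center k (K : {pred G}) :
  (forall a b, K a -> K b -> compatible k a b) ->
  exists c, forall a, K a -> a - shift_exponent c \in level m.+2 n k.
Proof.
move=> Kc; suff [c cP] : exists c, forall a d, K a -> (k < nvars a d)%N -> d = c.
  exists c => a Ka; rewrite inE; apply/forallP => i; apply/implyP => i0.
  rewrite nvarsB leqNgt; apply/negP => /(cP _ _ Ka).
  by rewrite -[RHS]add0r => /addIr i0'; rewrite i0' in i0.
have [/existsP[a /andP[Ka /forallPn[c ac]]] | none] :=
  boolP [exists a, K a && ~~ light k a].
  rewrite -ltnNge in ac; exists c => b d Kb bd.
  by have /compatibleP := Kc b a Kb Ka; apply.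
exists 0 => a d Ka; rewrite ltnNge => /negP[].
have /existsPn/(_ a) := none; rewrite Ka /= negbK => /forallP; exact.
Qed.

End Graph.

(** * Sums of squares of real functions *)

Section RealSos.
Context (R : realType) (m n : nat).
Local Notation C := R[i].
Local Notation G := (exponent m n).
Implicit Types (S : {set G}) (h : rootbox R m n -> C).

Definition is_real_sos S h : Prop :=
  exists (r : nat) (g : 'I_r -> rootbox R m n -> R),
    (forall j, supported_on S (fun z => (g j z)%:C%C)) /\
    (forall z, h z = \sum_(j < r) `|(g j z)%:C%C| ^+ 2).

Lemma is_real_sos0 S h : (forall z, h z = 0) -> is_real_sos S h.
Proof.
move=> h0; exists 0%N, (fun _ _ => 0); split=> [[]//|z]; by rewrite big_ord0.
Qed.

Lemma is_real_sosD S h1 h2 h : (forall z, h z = h1 z + h2 z) ->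
  is_real_sos S h1 -> is_real_sos S h2 -> is_real_sos S h.
Proof.
move=> hE [r1 [g1 [g1S h1E]]] [r2 [g2 [g2S h2E]]].
exists (r1 + r2)%N, (fun j => match split j with inl i => g1 i | inr i => g2 i end).
split=> [j | z]; first by case: (split j).
rewrite hE h1E h2E big_split_ord; congr (_ + _); apply: eq_bigr => i _.
  by rewrite (unsplitK (inl i)).
by rewrite (unsplitK (inr i)).
Qed.

Lemma is_real_sos_sum (I : eqType) (r : seq I) S (F : I -> rootbox R m n -> C) h :
  (forall z, h z = \sum_(i <- r) F i z) ->
  (forall i, i \in r -> is_real_sos S (F i)) -> is_real_sos S h.
Proof.
elim: r h => [|i r IH] h hE hF.
  by apply: is_real_sos0 => z; rewrite hE big_nil.
apply: (is_real_sosD (h1 := F i) (h2 := fun z => \sum_(j <- r) F j z)).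
- by move=> z; rewrite hE big_cons.
- by apply: hF; rewrite mem_head.
- by apply: IH => // j jr; apply: hF; rewrite inE jr orbT.
Qed.

Lemma is_real_sos_sqr S (g : rootbox R m n -> R) :
  supported_on S (fun z => (g z)%:C%C) ->
  is_real_sos S (fun z => (`|(g z)%:C%C| ^+ 2)).
Proof. by move=> gS; exists 1%N, (fun _ => g); split=> // z; rewrite big_ord1. Qed.

Lemma supported_on_lin S h1 h2 h x y : (forall z, h z = x * h1 z + y * h2 z) ->
  supported_on S h1 -> supported_on S h2 -> supported_on S h.
Proof.
move=> hE [c1 h1E] [c2 h2E]; exists (fun a => x * c1 a + y * c2 a) => z.
rewrite hE h1E h2E !mulr_sumr -big_split; apply: eq_bigr => a _ /=; ring.
Qed.

Lemma is_sos_real k h : is_real_sos (level m n k) h -> is_sos k h.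
Proof. by case=> r [g [gS hE]]; exists r, (fun j z => (g j z)%:C%C). Qed.

End RealSos.

(** * Quadratic forms on the box *)

Section RootBox.
Context (R : realType) (m n : nat).
Local Notation C := R[i].
Local Notation G := (exponent m.+2 n).
Implicit Types (a b g : G) (z : rootbox R m.+2 n).

Definition coord z : 'I_n -> C := fun l => val z l ord0.

Lemma coordX z l : coord z l ^+ m.+2 = 1.
Proof. by have /forallP/(_ l)/eqP := valP z. Qed.

Lemma box_point (x : 'I_n -> C) : (forall l, x l ^+ m.+2 = 1) ->
  exists z, coord z =1 x.
Proof.
move=> x1; have xP : [forall l, (\col_i x i) l ord0 ^+ m.+2 == 1].
  by apply/forallP => l; rewrite mxE x1.
by exists (exist _ (\col_i x i) xP) => l; rewrite /coord /= mxE.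
Qed.

Lemma monomialE a z : monomial a z = char (coord z) a.
Proof. by []. Qed.

Lemma supported_on_sum (S : {set G}) (u : G -> C) :
  (forall a, u a != 0 -> a \in S) ->
  supported_on S (fun z => \sum_a u a * char (coord z) a).
Proof.
move=> uS; exists u => z; rewrite [RHS]big_mkcond; apply: eq_bigr => a _.
by case: ifPn => // aS; rewrite (contraNeq (uS a) aS) mul0r.
Qed.

(** Negation exchanges the multiplicities of the residues [i] and [- i] and fixes
that of [0]. *)
Lemma levelN k a : (- a \in level m.+2 n k) = (a \in level m.+2 n k).
Proof.
have gt0 (i : 'I_m.+2) : (0 < - i)%N = (0 < i)%N.
  by have := oppr_eq0 i; rewrite -!val_eqE !lt0n => ->.
rewrite !inE; apply/forallP/forallP => al i.
  by have := al (- i); rewrite nvarsN opprK gt0.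
by rewrite nvarsN -gt0.
Qed.

Lemma supported_on_conj k h : supported_on (level m.+2 n k) h ->
  supported_on (level m.+2 n k) (fun z => (h z)^*).
Proof.
case=> c hE; exists (fun a => (c (- a))^*) => z.
rewrite hE rmorph_sum (reindex (fun a : G => - a)) /=; last first.
  by exists (fun a : G => - a) => a _; rewrite opprK.
apply: eq_big => a; first exact: levelN.
by rewrite rmorphM /= !monomialE charN ?conjCK //; apply: coordX.
Qed.

(** [|h|^2 = Re(h)^2 + Im(h)^2], where both parts are combinations of [h] and of
its conjugate. *)
Lemma is_real_sos_normsq k h : supported_on (level m.+2 n k) h ->
  is_real_sos (level m.+2 n k) (fun z : rootbox R m.+2 n => `|h z| ^+ 2).
Proof.
move=> hS; have hcS := supported_on_conj hS.
apply: (is_real_sosD (h1 := fun z => `|(complex.Re (h z))%:C%C| ^+ 2)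
                     (h2 := fun z => `|(complex.Im (h z))%:C%C| ^+ 2)).
- move=> z; rewrite -add_Re2_Im2 rmorphD !rmorphXn /=.
  by rewrite !real_normK ?complex_real.
- apply: is_real_sos_sqr; apply: (supported_on_lin (x := 2^-1) (y := 2^-1)) hS hcS => z.
  by rewrite ReJ_add; field.
- apply: is_real_sos_sqr.
  apply: (supported_on_lin (x := - 'i%C / 2) (y := 'i%C / 2)) hS hcS => z.
  by rewrite ImJ_sub; field.
Qed.

Definition unit_exponent (i : 'I_n) : G := [ffun l => if l == i then 1 else 0].

Lemma char_unit_exponent (x : 'I_n -> C) i : char x (unit_exponent i) = x i.
Proof.
rewrite /char (bigD1 i) //= big1 => [|l li]; last by rewrite ffunE (negPf li).
by rewrite ffunE eqxx mulr1.
Qed.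

Definition quad_coef (Q : 'M[C]_n) g : C :=
  \sum_i \sum_j Q i j * (g == unit_exponent j - unit_exponent i)%:R.

Lemma quad_form_char (Q : 'M[C]_n) z :
  quad_form Q z = \sum_g quad_coef Q g * char (coord z) g.
Proof.
rewrite quad_formE //; under [RHS]eq_bigr => g _ do rewrite mulr_suml.
rewrite [RHS]exchange_big; apply: eq_bigr => i _ /=.
under [RHS]eq_bigr => g _ do rewrite mulr_suml.
rewrite [RHS]exchange_big; apply: eq_bigr => j _ /=.
rewrite (bigD1 (unit_exponent j - unit_exponent i)) //= eqxx big1 => [|g ne_g].
  rewrite addr0 mulr1 charB; last exact: coordX.
  rewrite !char_unit_exponent (mulr1_eq (y := (coord z i)^*)).
    by rewrite -mulrA; congr (_ * _); rewrite mulrC.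
  by apply: (@unity_conj _ m.+2) => //; apply: coordX.
by rewrite (negPf ne_g) mulr0 mul0r.
Qed.

(** A nonzero coefficient at [a - b] means [a - b = e_j - e_i], so that [a] and [b]
differ at most at [i] and [j]. *)
Lemma quad_coef_sparse (Q : 'M[C]_n) k a b : (n < k.*2)%N ->
  quad_coef Q (a - b) != 0 -> compatible k a b.
Proof.
move=> ltnk; have [/existsP[i /existsP[j /eqP abij]] _ | none] :=
  boolP [exists i, exists j, a - b == unit_exponent j - unit_exponent i].
  apply: (@compatible_edit _ _ _ _ _ i j) => // l li lj.
  apply/eqP; rewrite -subr_eq0; apply/eqP.
  by move/ffunP/(_ l): abij; rewrite !ffunE (negPf li) (negPf lj) subr0.
case/negP; apply/eqP; apply: big1 => i _; apply: big1 => j _.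
by have /existsPn/(_ i)/existsPn/(_ j)/negPf -> := none; rewrite mulr0.
Qed.

(** Each clique-supported square given by [chordal_sos] is moved to level [k] by
dividing by the monomial with constant exponent [c] of [clique_center], and then
split into real and imaginary parts. *)
Lemma quad_form_real_sos (Q : 'M[C]_n) k : (n < k.*2)%N ->
  (forall z, 0 <= quad_form Q z) -> is_real_sos (level m.+2 n k) (@quad_form R m.+2 n Q).
Proof.
move=> ltnk Q0; have [zeta zeta_prim] := @prim_root_exists C m.+2 isT.
have [|x x1|us [us_clique us_sum]] := chordal_sos zeta_prim (phat := quad_coef Q)
   (@compatible_elim_order m n k).
- by move=> a b; apply: quad_coef_sparse.
- have [z zx] := box_point x1; have := Q0 z; rewrite quad_form_char.
  congr (0 <= _); apply: eq_bigr => g _; congr (_ * _).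
  by apply: eq_bigr => l _; rewrite zx.
apply: (is_real_sos_sum (r := us)
  (F := fun u z => `|\sum_a u a * char (coord z) a| ^+ 2)) => [z|u uus].
  by rewrite quad_form_char us_sum //; apply: coordX.
have [|c cP] := @clique_center m n k [pred a | u a != 0].
  by move=> a b; apply: us_clique.
have vS : supported_on (level m.+2 n k)
    (fun z => \sum_(b : G) u (b + shift_exponent n c) * char (coord z) b).
  by apply: supported_on_sum => b /cP; rewrite addrK.
have [r [g [gS hE]]] := is_real_sos_normsq vS; exists r, g; split=> // z.
rewrite -hE [X in `|X| ^+ 2 = _](_ : _ = char (coord z) (shift_exponent n c) *
  \sum_(b : G) u (b + shift_exponent n c) * char (coord z) b).
  rewrite normrM; suff -> : `|char (coord z) (shift_exponent n c)| = 1 by rewrite mul1r.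
  apply/eqP; rewrite -(pexpr_eq1 (n := 2)) // normCK char_conj //; exact: coordX.
rewrite (reindex (fun b : G => b + shift_exponent n c)) /=; last first.
  by exists (fun a => a - shift_exponent n c) => a _; rewrite ?addrK ?subrK.
rewrite mulr_sumr; apply: eq_bigr => b _; rewrite charD; last exact: coordX.
by ring.
Qed.

Lemma quad_form_id z : quad_form 1%:M z = n%:R.
Proof.
rewrite quad_formE // (eq_bigr (fun=> 1)) ?sumr_const ?card_ord // => i _.
rewrite (bigD1 i) //= big1 ?addr0 => [|j ji]; last first.
  by rewrite mxE eq_sym (negPf ji) !mul0r.
rewrite mxE eqxx mul1r mulVf //; apply/eqP => zi0.
by have := coordX z i; rewrite /coord zi0 expr0n => /eqP; rewrite eq_sym oner_eq0.
Qed.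

Lemma quad_formB (x : C) (Q : 'M[C]_n) z :
  quad_form (x%:M - Q) z = x * n%:R - quad_form Q z.
Proof.
rewrite -(quad_form_id z) /quad_form -(scalemx1 _ x) mulmxBr mulmxBl.
rewrite -scalemxAr -scalemxAl.
by rewrite [LHS]mxE [X in X + _]mxE [X in _ + X]mxE.
Qed.

Lemma quad_form_conj (Q : 'M[C]_n) z : Q \is hermsymmx ->
  (quad_form Q z)^* = quad_form Q z.
Proof.
move=> /is_hermitianmxP; rewrite expr0 scale1r => QE.
have := coordX z; rewrite /coord => zX.
have zV i : (val z i ord0)^-1 = (val z i ord0)^*.
  by apply: mulr1_eq; apply: (@unity_conj _ m.+2).
rewrite !quad_formE // rmorph_sum exchange_big /=; apply: eq_bigr => i _.
rewrite rmorph_sum /=; apply: eq_bigr => j _.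
rewrite !rmorphM /= !zV conjCK.
have -> : (Q i j)^* = Q j i by rewrite [in RHS]QE !mxE.
by rewrite mulrAC.
Qed.

(** The box is finite, being the image of the exponents under [root_point], and a
Hermitian form is real, so a maximum exists. *)
Lemma quad_max_exists (Q : 'M[C]_n) : Q \is hermsymmx ->
  exists v : R, is_quad_max m.+2 Q v.
Proof.
move=> hQ; have [zeta zeta_prim] := @prim_root_exists C m.+2 isT.
have quadE (d : G) z : coord z =1 root_point zeta d ->
    quad_form Q z = \sum_g quad_coef Q g * char (root_point zeta d) g.
  move=> zd; rewrite quad_form_char; apply: eq_bigr => g _; congr (_ * _).
  by apply: eq_bigr => l _; rewrite zd.
pose p (d : G) : R := complex.Re (\sum_g quad_coef Q g * char (root_point zeta d) g).
have quad_p (d : G) z : coord z =1 root_point zeta d -> quad_form Q z = (p d)%:C%C.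
  move=> zd; rewrite /p -(quadE _ _ zd) RRe_real // CrealE.
  by apply/eqP; apply: quad_form_conj.
have [d _ d_max] := @arg_maxP _ R G 0 predT p isT.
exists (p d); split=> [|z].
  have [z zd] := box_point (root_pointX zeta_prim d).
  by exists z; apply: quad_p.
pose b : G := [ffun l => sval (prim_rootP zeta_prim (coordX z l))].
rewrite (quad_p b) ?lecR; first exact: d_max.
by move=> l; rewrite /root_point ffunE; case: (prim_rootP _ _).
Qed.

Lemma is_sos_ge0 k h z : @is_sos R m.+2 n k h -> 0 <= h z.
Proof. by case=> r [g [_ ->]]; apply: sumr_ge0 => j _; rewrite exprn_ge0. Qed.

End RootBox.

Local Open Scope complex_scope.

Theorem theorem1 (R : realType) (m n : nat) (hm : (2 <= m)%N) (hn : (1 <= n)%N)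
    (Q : 'M[R[i]]_n) (hQ : Q \is hermsymmx) :
  ((forall z : rootbox R m n, 0 <= quad_form Q z) ->
   exists (r : nat) (g : 'I_r -> rootbox R m n -> R),
     (forall j, supported_on (level m n (n %/ 2).+1) (fun z => (g j z)%:C)) /\
     (forall z, quad_form Q z = \sum_(j < r) `|(g j z)%:C| ^+ 2)) /\
  sos_exact m (n %/ 2).+1 Q.
Proof.
case: m hm => [|[|m]] // _.
have ltnk : (n < (n %/ 2).+1.*2)%N by lia.
split; first exact: quad_form_real_sos.
have [v v_max] := quad_max_exists m hQ; exists v; split=> //.
have [[z0 z0v] v_ub] := v_max.
have v_feasible : sos_feasible m.+2 (n %/ 2).+1 Q v.
  apply: is_sos_real.
  have vE (z : rootbox R m.+2 n) :
      v%:C - quad_form Q z = quad_form ((v%:C / n%:R)%:M - Q) z.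
    by rewrite quad_formB divfK // pnatr_eq0 -lt0n.
  have [|r [g [gS gE]]] := @quad_form_real_sos R m n ((v%:C / n%:R)%:M - Q) _ ltnk.
    by move=> z; rewrite -vE subr_ge0.
  by exists r, g; split=> // z; rewrite vE.
apply/eqP; rewrite eq_le; apply/andP; split.
  by apply: ereal_inf_lbound; exists v.
apply: le_ereal_inf_tmp => _ [t t_feasible <-].
rewrite lee_fin -lecR -z0v -subr_ge0.
exact: is_sos_ge0 t_feasible.
Qed.
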